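(* Let $R$ be a finite group of squarefree order. If $R$ is not abelian and $R$ is not isomorphic to any of $\mathrm{D}_6$, $\mathrm{D}_{10}$, $\mathrm{D}_{30}$, $\mathrm{D}_6\times\mathrm{C}_q$, $\mathrm{D}_{10}\times \mathrm{C}_q$, or $\mathrm{C}_q\rtimes\mathrm{C}_p$ (for primes $p,q$), then $R$ is not GRR-detecting.
   Context: $\mathrm{C}_n$ is the cyclic group of order $n$, $\mathrm{D}_{2n}$ the dihedral group of order $2n$. For a group $R$ and $S\subseteq R$, the Cayley digraph $\mathrm{Cay}(R,S)$ has vertex set $R$ and an arc from $r$ to $sr$ whenever $s\in S$. It is a GRR if $S=S^{-1}$ and $\mathrm{Aut}(\mathrm{Cay}(R,S))$ equals the right regular representation $\hat R$. $\mathrm{Aut}(R)_S$ is the group of automorphisms of $R$ fixing $S$ setwise. $R$ is GRR-detecting if for every $S\subseteq R$ with $S=S^{-1}$, $\mathrm{Aut}(R)_S=1$ implies $\mathrm{Cay}(R,S)$ is a GRR. *)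

(* Defs.v *)
From mathcomp Require Import all_boot all_fingroup all_solvable.
Set Implicit Arguments. Unset Strict Implicit. Unset Printing Implicit Defensive.
Local Open Scope group_scope.

Definition squarefree (n : nat) : Prop :=
  forall p : nat, prime p -> ~ (p * p %| n)%N.

Section Cayley.
Variable gT : finGroupType.

(* Automorphism group of the Cayley digraph Cay(R,S), R = [set: gT]:
   arcs r -> s r (s in S), i.e. (x,y) is an arc iff y * x^-1 \in S. *)
Definition CayAut (S : {set gT}) : {set {perm gT}} :=
  [set f : {perm gT} | [forall x, forall y,
      (y * x^-1 \in S) == (f y * (f x)^-1 \in S)]].

Definition rreg : {set {perm gT}} :=
  [set f : {perm gT} | [exists g, [forall x, f x == x * g]]].

Definition isGRR (S : {set gT}) : Prop :=
  S^-1 = S /\ CayAut S = rreg.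

Definition AutS (S : {set gT}) : {set {perm gT}} :=
  [set a in Aut [set: gT] | a @: S == S].

Definition GRR_detecting : Prop :=
  forall S : {set gT}, S^-1 = S -> AutS S = 1 -> isGRR S.
End Cayley.

(* Main.v *)
(** Every group R of squarefree order is a semidirect product (<x> x <z>) : <k>
    with <x> = R' odd, z central, and k acting on <x> without fixed points.  Put
    F = <x><z> = C(R'), which is cyclic, and consider connection sets
    S = S0 u Wk' u (Wk')^-1 with S0, W in F and k' in <k>.  An automorphism f of
    R preserving S fixes the coset Fk', so it preserves S0, and f(W)t = W for
    some t in R'; with S0 containing a generator of F and its inverse, f acts on
    F as +1 or -1, and a subset W such as {1, x, x^3} without dihedral symmetry
    (available as soon as x has order at least 7) forces f = 1.  On the other
    hand, if N <> 1 is normal in R, N <= H < R, and S \ H is a union of cosets of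
    N, then right translation by an element of N on H, extended by the identity
    outside H, is an automorphism of Cay(R,S) outside the regular
    representation.  The two requirements can be met together as follows:
    - z <> 1 and |x| >= 7: H = F and N = <z>;
    - |z| composite: H = F and N a proper nontrivial subgroup of <z>;
    - z = 1 and |x| composite with a prime factor p >= 7: N of order p in R' and
      H = N<k>;
    - z = 1, |x| >= 7 prime, |k| composite: N = R' and H = R'<k'> with <k'> a
      proper subgroup of <k>.
    If z <> 1, what is left is |z| prime and |x| = 3 or 5.  If z = 1, it is
    |x| = 15, or |x| = 3 or 5, or |x| and |k| both prime.  When |x| is 3, 5 or 15,
    |k| is squarefree and divides the power of two phi(|x|), so |k| = 2. *)

Require Import Defs.
From mathcomp Require Import all_boot all_fingroup all_solvable all_algebra.
Set Implicit Arguments. Unset Strict Implicit. Unset Printing Implicit Defensive.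
Local Open Scope group_scope.

(** * Groups of squarefree order: transfer and the derived subgroup *)

(** The transfer into [P] maps [g \in P] to [g ^+ #|G : P|] and kills [G^`(1)]. *)
Lemma transfer_not_sub_der1 (gT : finGroupType) (G P : {group gT}) :
  P \subset G -> prime #|P| -> coprime #|P| #|G : P| -> 'N_G(P) \subset 'C(P) ->
  ~~ (P \subset G^`(1)).
Proof.
move=> sPG pP coPG sNC; apply/negP=> sPG'.
have cPP : abelian P by rewrite cyclic_abelian ?prime_cyclic.
have abP : abelian (idm_morphism P @* P) by rewrite morphim_idm.
have [g Pg ng] : exists2 g, g \in P & g != 1.
  by apply/trivgPn; rewrite -cardG_gt1 prime_gt1.
have Gg := subsetP sPG _ Pg.
have T0 : transfer G abP g = 1.
  apply/set1P; rewrite -[[set 1]]/(1 : {set _}).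
  have <- : transfer G abP @* G^`(1) = 1.
    have := morphim_der (transfer_morphism G abP) 1 (subxx G) => /= ->.
    by apply/commG1P; apply: FinRing.zmod_abelian.
  by rewrite mem_morphim // (subsetP sPG').
have trX := transversalP (rcosets_cycle_partition sPG Gg).
rewrite (transfer_cycle_expansion sPG abP Gg trX) in T0.
move: T0; rewrite (eq_bigr (fun x => FiniteModule.fmod abP (g ^+ #|<[g]> : P :* x|)));
  last first.
  move=> x Xx /=; set n := #|_ : _|.
  have Gx : x \in G by apply: (subsetP (transversal_sub trX)).
  congr (FiniteModule.fmod abP _); rewrite /idm.
  have: x * g ^+ n \in P :* x by exact: mulg_exp_card_rcosets.
  rewrite mem_rcoset => Ph.
  have [->|nt] := eqVneq (g ^+ n) 1; first by rewrite conj1g.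
  (* A nontrivial [g ^+ n] generates [P], which has prime order. Its conjugate by [x^-1] is again in
     [P], so [x^-1] normalises and hence centralises [P]: every term of the transfer is the plain
     power [g ^+ n]. *)
  have defP : P = <[g ^+ n]> :> {set gT}.
    apply/esym/eqP; rewrite eqEcard cycle_subG groupX //=.
    suff -> : #|<[g ^+ n]>| = #|P| by [].
    by apply/(prime_nt_dvdP pP); rewrite ?order_eq1 ?order_dvdG ?groupX.
  have Nx : x^-1 \in 'N(P).
    by rewrite inE {1}defP -cycleJ cycle_subG conjgE invgK mulgA.
  have := subsetP sNC x^-1; rewrite inE groupV Gx Nx => /(_ isT) /centP Cx.
  by rewrite conjgE -(Cx (g ^+ n)) ?groupX // mulKg.
have fX n : FiniteModule.fmod abP (g ^+ n) = (FiniteModule.fmod abP g *+ n)%R.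
  by rewrite FiniteModule.fmodX /= ?morphim_idm.
rewrite (eq_bigr _ (fun x _ => fX _)) GRing.sumrMnr.
(* The cycle lengths add up to [#|G : P|], an exponent prime to the order of [g]. *)
rewrite (sum_index_rcosets_cycle sPG Gg trX) -fX.
move/(congr1 val); rewrite FiniteModule.fmodK /= ?morphim_idm ?groupX //.
move=> gn; case/negP: ng; rewrite -order_eq1.
by rewrite -dvdn1 -(eqP (coprime_dvdl (order_dvdG Pg) coPG)) dvdn_gcd dvdnn order_dvdn gn
  eqxx.
Qed.
Lemma squarefree_dvdn m n : (m %| n)%N -> squarefree n -> squarefree m.
Proof. by move=> dmn sqn p pp /dvdn_trans/(_ dmn); apply: sqn. Qed.

Lemma squarefree_coprime m n : squarefree (m * n) -> coprime m n.
Proof.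
move=> sq; rewrite coprime_has_primes; last 2 first.
(* [squarefree] excludes 0, which 4 divides, so both factors are positive. *)
- by case: m sq => // /(_ 2 isT) [].
- by case: n sq => //; rewrite muln0 => /(_ 2 isT) [].
apply/hasPn => p; rewrite !mem_primes => /and3P[pp _ pn].
apply/negP=> /and3P[_ _ pm]; apply: (sq _ pp); exact: dvdn_mul.
Qed.

Lemma squarefree_Sylow (gT : finGroupType) (G P : {group gT}) p :
  squarefree #|G| -> prime p -> p.-Sylow(G) P -> (#|P| %| p)%N.
Proof.
move=> sqG pp sylP; rewrite (card_Hall sylP) p_part.
rewrite -[X in (_ %| X)%N]expn1 dvdn_exp2l // leqNgt; apply/negP => l1.
by apply: (sqG p pp); rewrite -[(p * p)%N]/(p ^ 2)%N pfactor_dvdn.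
Qed.

Lemma squarefree_Zgroup (gT : finGroupType) (G : {group gT}) :
  squarefree #|G| -> Zgroup G.
Proof.
move=> sqG; apply/forall_inP=> P /SylowP[p pp sylP].
have dP := squarefree_Sylow sqG pp sylP.
have /orP[/eqP P1|/eqP Pp] := (primeP pp).2 _ dP.
  by rewrite (card1_trivg P1) cyclic1.
by rewrite prime_cyclic ?Pp.
Qed.

(** Conjugation embeds the quotient in [Aut C], of order [totient #|C|]. *)
Lemma card_quotient_cent_cyclic (gT : finGroupType) (G C : {group gT}) :
  G \subset 'N(C) -> cyclic C -> (#|G / 'C_G(C)| %| totient #|C|)%N.
Proof.
move=> nCG cycC.
rewrite -ker_conj_aut (card_isog (first_isog_loc _ _)) // -card_Aut_cyclic //.
exact: cardSg (Aut_conj_aut _ _).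
Qed.

(** Burnside's argument at the least prime divisor [p] of [#|G|]: for a Sylow [p]-subgroup [P], the
    normaliser modulo the centraliser has order dividing both [p.-1] and [#|G|], hence is trivial,
    and the transfer keeps [P] out of the derived subgroup. *)
Lemma squarefree_der1_proper (gT : finGroupType) (G : {group gT}) :
  squarefree #|G| -> G :!=: 1 -> G^`(1) \proper G.
Proof.
move=> sqG ntG; rewrite properEneq der_sub andbT; apply/eqP=> perfG.
pose p := pdiv #|G|.
have pp : prime p by rewrite pdiv_prime ?cardG_gt1.
have [P sylP] := Sylow_exists p G.
have sPG := pHall_sub sylP.
have oP : #|P| = p.
  apply/(prime_nt_dvdP pp); last exact: squarefree_Sylow sylP.
  by rewrite (card_Hall sylP) p_part -[1%N]/(p ^ 0)%N eqn_exp2l ?prime_gt1 // -lt0n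
    logn_gt0 mem_primes pp cardG_gt0 pdiv_dvd.
suff /negP[] : ~~ (P \subset G^`(1)) by rewrite perfG.
apply: transfer_not_sub_der1; rewrite ?oP //.
  by rewrite -{1}oP; case/andP: (pHall_Hall sylP).
have nPN : 'N_G(P) \subset 'N(P) by apply: subsetIr.
suff : #|'N_G(P) / 'C_('N_G(P))(P)| = 1%N.
  move/card1_trivg => /trivgP; rewrite quotient_sub1 ?subsetI.
    by case/andP.
  by rewrite normsI ?norms_cent // normG.
apply/eqP; rewrite -trivg_card1; apply/idPn; rewrite -cardG_gt1.
set Q := ('N_G(P) / _)%G => oQ.
have dQ : (#|Q| %| (p.-1))%N.
  by rewrite -(totient_prime pp) -oP card_quotient_cent_cyclic ?prime_cyclic ?oP.
have : (pdiv #|Q| < p)%N.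
  apply: leq_ltn_trans (pdiv_leq _) _ => //; rewrite ?cardG_gt0 //.
  apply: leq_ltn_trans (dvdn_leq _ dQ) _; last by rewrite prednK ?prime_gt0.
  by rewrite -subn1 subn_gt0 prime_gt1.
rewrite ltnNge => /negP[]; apply: pdiv_min_dvd; first by rewrite prime_gt1 ?pdiv_prime.
apply: dvdn_trans (pdiv_dvd _) _; apply: dvdn_trans (dvdn_quotient _ _) _.
exact: cardSg (subsetIl _ _).
Qed.

(** [G^`(1)] centralises the cyclic group [G^`(2)], because [Aut G^`(2)] is abelian;
    since [G^`(1) / G^`(2)] is cyclic, [G^`(1)] is abelian. *)
Lemma squarefree_der1_cyclic (gT : finGroupType) (G : {group gT}) :
  squarefree #|G| -> cyclic G^`(1).
Proof.
have [n] := ubnP #|G|; elim: n => // n IHn in G *; move=> /ltnSE leGn sqG.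
have [->|ntG] := eqVneq (G : {set gT}) 1; first by rewrite derg1 commG1 cyclic1.
have sqG' : squarefree #|G^`(1)| by apply: squarefree_dvdn sqG; rewrite cardSg ?der_sub.
have ltG' := proper_card (squarefree_der1_proper sqG ntG).
have cycG'' : cyclic G^`(1)^`(1) by apply: IHn sqG'; apply: leq_trans leGn.
have nG'' : G \subset 'N(G^`(2)) by apply: der_norm.
have cG' : G^`(1) \subset 'C(G^`(2)).
  have : G^`(1) \subset 'C_G(G^`(2)).
    apply: der1_min; first by rewrite normsI ?normG ?norms_cent.
    rewrite /= -(ker_conj_aut (G^`(2))%G) (isog_abelian (first_isog_loc _ _)) //.
    exact: abelianS (Aut_conj_aut _ _) (Aut_cyclic_abelian _).
  by rewrite subsetI => /andP[].
have abG' : abelian G^`(1).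
  apply: (@cyclic_factor_abelian _ (G^`(2))).
    by rewrite subsetI der_subS centsC.
  apply: nil_Zgroup_cyclic (abelian_nil (der_abelian 1 G)).
  exact/morphim_Zgroup/squarefree_Zgroup.
apply: nil_Zgroup_cyclic (abelian_nil abG'); exact: squarefree_Zgroup.
Qed.

(** * The metacyclic decomposition *)

(** [x] generates the derived subgroup, [<[x]> * <[z]>] is the Fitting subgroup,
    and [z], [k] generate the two factors of a complement of [<[x]>]. *)
Record metacyclic_data (gT : finGroupType) (x z k : gT) : Prop := MetacyclicData {
  md_der : [set: gT]^`(1) = <[x]>;
  md_central : z \in 'Z([set: gT]);
  md_cent : 'C(<[x]>) = <[x]> * <[z]>;
  md_prod : <[x]> * <[z]> * <[k]> = [set: gT];
  md_coxz : coprime #[x] #[z];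
  md_coxk : coprime #[x] #[k];
  md_cozk : coprime #[z] #[k];
  md_faithful : <[k]> :&: 'C(<[x]>) = 1;
  md_regular : 'C_<[x]>[k] = 1 }.

(** The derived subgroup [A] is a normal Hall subgroup, so Schur-Zassenhaus gives a complement [K],
    cyclic because it is abelian with cyclic Sylow subgroups. Then [z] generates the centraliser [Z]
    of [A] in [K], and [k] generates the complement of [Z] in [K]. *)
Lemma squarefree_metacyclic (gT : finGroupType) :
  squarefree #|gT| -> exists x z k : gT, metacyclic_data x z k.
Proof.
rewrite -cardsT => sqG; set G := [set: gT]%G.
have [A derA] : exists A : {group gT}, A = G^`(1) :> {set gT} by exists (G^`(1))%G.
have [x defA] := cyclicP (squarefree_der1_cyclic sqG); rewrite -derA in defA.
have nsA : A <| G by rewrite derA der_normal.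
have nAG := normal_norm nsA.
have hallA : Hall G A.
  rewrite /Hall normal_sub //=; apply: squarefree_coprime.
  by rewrite Lagrange ?normal_sub.
have /splitsP[K /complP[tiAK defG]] := SchurZassenhaus_split hallA nsA.
have isoK : K \isog G / A by rewrite -defG quotientMidl quotient_isog // ?subsetT //
  (subset_trans (subsetT K)).
have sKG : K \subset G by apply: subsetT.
have nAK := subset_trans sKG nAG.
have sqK : squarefree #|K| by apply: squarefree_dvdn sqG; rewrite cardSg.
have abK : abelian K by rewrite (isog_abelian isoK) sub_der1_abelian ?derA.
have cycK : cyclic K by apply: nil_Zgroup_cyclic (abelian_nil abK);
  apply: squarefree_Zgroup.
have abA : abelian A by rewrite defA cycle_abelian.
have coAK : coprime #|A| #|K|.
  by apply: squarefree_coprime; rewrite -TI_cardMg // defG.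
have CAK : 'C_A(K) = 1.
  (* Modulo [[~: A, K]] the whole group is a product of two commuting abelian images, so this
     commutator contains the derived subgroup [A]. Coprime action then leaves no fixed points. *)
  have {1}<- : [~: A, K] = A.
    apply/eqP; rewrite eqEsubset commg_subl nAK /=.
    rewrite {1}derA der1_min //= -defG.
      by rewrite mulG_subG commg_norml commg_normr.
    have nAA : A \subset 'N([~: A, K]) by apply: commg_norml.
    rewrite quotientMl // abelianM !quotient_abelian //=.
    by rewrite quotient_cents2r // commGC.
  exact: coprime_abel_cent_TI.
pose Z := 'C_K(A)%G.
have sZK : Z \subset K by apply: subsetIl.
have [z defZ] := cyclicP (cyclicS sZK cycK).
have [kk defkk] := cyclicP cycK.
pose k := kk ^+ #|Z|.
have ok : #[k] = (#|K| %/ #|Z|)%N.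
  by rewrite /k orderXdiv /order -defkk ?cardSg.
have sqZk : squarefree (#|Z| * #[k]).
  by rewrite ok mulnC divnK ?cardSg.
have coZk := squarefree_coprime sqZk.
have kK : k \in K by rewrite defkk mem_cycle.
have defKZ : Z * <[k]> = K.
  apply/eqP; rewrite eqEcard mul_subG ?cycle_subG //=.
  by rewrite coprime_cardMg // -/(order k) ok mulnC divnK ?cardSg.
have CA : 'C(A) = A * Z.
  by rewrite -[LHS]setTI -/(G : {set gT}) -defG setIC group_modl // setIC.
exists x, z, k; split; rewrite -?defA -?defZ //.
- rewrite inE in_setT -/G -defG /= centM inE.
  have : z \in Z by rewrite /= defZ cycle_id.
  by rewrite inE => /andP[zK ->]; rewrite (subsetP abK).
- by rewrite -mulgA defKZ.
- by rewrite /order -defA -defZ (coprimegS _ coAK).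
- by rewrite /order -defA (coprimegS _ coAK) ?cycle_subG.
- by rewrite /order -defZ.
- apply/trivgP; rewrite -(coprime_TIg coZk) subsetI subsetIl andbT.
  by rewrite setSI ?cycle_subG.
- apply/trivgP/subsetP=> u /setIP[Au ku].
  (* [Z] centralises [A], so an element of [A] commuting with [k] commutes with all of [K]. *)
  have sAZ : A \subset 'C(Z) by rewrite centsC subsetIr.
  suff : u \in 'C_A(K) by rewrite CAK.
  rewrite -defKZ centM cent_cycle; apply/setIP; split=> //.
  by apply/setIP; split=> //; apply: (subsetP sAZ).
Qed.

(** * Non-regular automorphisms of Cayley graphs *)

(** Right translation by [n \in N] on [H], extended by the identity, is an
    automorphism of the Cayley graph with fixed points outside [H]. *)
Lemma CayAut_neq_rreg (gT : finGroupType) (S : {set gT}) (N H : {group gT}) :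
    N <| [set: gT] -> N :!=: 1 -> N \subset H -> H \proper [set: gT] ->
    (forall s n, s \in S -> s \notin H -> n \in N -> s * n \in S) ->
  CayAut S != rreg gT.
Proof.
move=> nN ntN sNH ltHG SN; have [n Nn nt] := trivgPn _ ntN.
have [h _ nHh] : exists2 h, h \in [set: gT] & h \notin H by case/properP: ltHG.
have Hn := subsetP sNH n Nn.
have NJ m y : m \in N -> m ^ y \in N by move=> Nm;
  rewrite memJ_norm // (subsetP (normal_norm nN)) ?inE.
have SNE s m : s \notin H -> m \in N -> (s * m \in S) = (s \in S).
  move=> nHs Nm; apply/idP/idP => [Ssm|Ss]; last exact: SN.
  rewrite -(mulgK m s) SN ?groupV //.
  by rewrite groupMr // (subsetP sNH).
pose f y := if y \in H then y * n else y.
have fI : injective f.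
  apply: (can_inj (g := fun y => if y \in H then y * n^-1 else y)) => y.
  by rewrite /f; case Hy: (y \in H); rewrite ?groupMr ?Hy ?mulgK.
apply/eqP=> eqCR; have : perm fI \in CayAut S.
  (* If both endpoints are in [H], the translation cancels in [v * u^-1]. If exactly one is,
     [v * u^-1] is outside [H] and gets multiplied by a conjugate of [n] or of [n^-1], which stays
     in [N]. *)
  rewrite inE; apply/forallP=> u; apply/forallP=> v; rewrite !permE /f.
  case Hu: (u \in H); case Hv: (v \in H) => //; apply/eqP.
  - by rewrite invMg mulgA mulgK.
  - have -> : v * (u * n)^-1 = v * u^-1 * n^-1 ^ u^-1 by rewrite conjgE invgK invMg
      !mulgA mulgKV.
    by rewrite (SNE (v * u^-1)) ?NJ ?groupV // groupMr ?groupV // Hv.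
  - have -> : v * n * u^-1 = v * u^-1 * n ^ u^-1 by rewrite conjgE invgK !mulgA mulgKV.
    by rewrite (SNE (v * u^-1)) ?NJ // groupMl // groupV Hu.
rewrite eqCR inE => /existsP[g /forallP fg].
(* A right translation fixing [h] is the identity, yet this map sends 1 to [n]. *)
have := fg h; rewrite permE /f (negPf nHh) -{1}[h]mulg1 (inj_eq (mulgI h)) => /eqP g1.
have := fg 1; rewrite permE /f group1 -g1 !mul1g => /eqP n1.
by rewrite n1 eqxx in nt.
Qed.

(** * Group automorphisms and the rigidity criterion *)

Section Rigidity.

Variables (gT : finGroupType) (x z k : gT).
Hypothesis D : metacyclic_data x z k.

Local Notation A := <[x]>.
Local Notation Z := <[z]>.
Local Notation F := 'C(A).

Lemma md_normal : A <| [set: gT].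
Proof. by rewrite -(md_der D) der_normal. Qed.

Lemma md_memJ u y : u \in A -> u ^ y \in A.
Proof. by move=> Au; rewrite memJ_norm // (subsetP (normal_norm md_normal)) ?inE. Qed.

Lemma md_mulC c y : c \in Z -> c * y = y * c.
Proof.
have /setIP[_ /centP Cz] := md_central D.
by case/cycleP=> i ->; apply/esym/commuteX/esym/Cz; rewrite inE.
Qed.

Lemma md_centP u : reflect (exists2 a, a \in A & exists2 c, c \in Z & u = a * c) (u \in F).
Proof.
rewrite (md_cent D); apply: (iffP mulsgP) => [[a c Aa Zc ->]|[a Aa [c Zc ->]]].
  by exists a => //; exists c.
by exists a c.
Qed.

Lemma md_cent_cycle : F = <[x * z]>.
Proof.
rewrite (md_cent D) cycleM ?(md_coxz D) //.
by apply/esym/md_mulC/cycle_id.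
Qed.

Lemma md_cent_char : F \char [set: gT].
Proof.
rewrite -[F]setTI; apply: subcent_char; first exact: char_refl.
by rewrite /= -(md_der D) gFchar.
Qed.

(** Subgroups of a cyclic group are characteristic in it, so automorphisms of the whole group act on
    [F] preserving each cyclic subgroup. *)
Lemma md_cyclic_char (H : {group gT}) : H \subset F -> H \char [set: gT].
Proof.
move=> sHF; apply: char_trans md_cent_char.
by rewrite sub_cyclic_char //= md_cent_cycle cycle_cyclic.
Qed.

Section Aut.
Variable f : {perm gT}.
Hypothesis Af : f \in Aut [set: gT].

Lemma Aut_setTM : {morph f : u v / u * v}.
Proof. by move=> u v; apply: (morphicP (Aut_morphic Af)); rewrite inE. Qed.

Lemma Aut_setT_morph1 : f 1 = 1.
Proof. by apply: (mulgI (f 1)); rewrite -Aut_setTM !mulg1. Qed.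

Lemma Aut_setTV : {morph f : u / u^-1}.
Proof. by move=> u; apply: (mulgI (f u)); rewrite -Aut_setTM !mulgV Aut_setT_morph1. Qed.

Lemma Aut_setTX i : {morph f : u / u ^+ i}.
Proof.
by move=> u; elim: i => [|i IH]; rewrite ?expg0 ?Aut_setT_morph1 // !expgS Aut_setTM IH.
Qed.

Lemma Aut_setT_char (H : {group gT}) u : H \char [set: gT] -> (f u \in H) = (u \in H).
Proof.
case/charP=> _ /(_ (autm_morphism Af) (injm_autm Af) (im_autm Af)) fH.
rewrite -{1}fH morphimEsub ?subsetT //= autmE mem_imset //; exact: perm_inj.
Qed.

Lemma Aut_setT_cyclic u : u \in F -> f u \in <[u]>.
Proof.
by move=> Fu; rewrite Aut_setT_char ?cycle_id // md_cyclic_char // cycle_subG.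
Qed.

(** On [A] the map [f] is a power map, hence commutes with conjugation; so [f k' * k'^-1]
    centralises [A] and has the form [a * c]. Raising [f k'] to the order [m] of [k'] puts [c ^+ m]
    in both [A] and [Z], and the order of [c] is prime to [m], so [c = 1]. *)
Lemma Aut_setT_shift k' : k' \in <[k]> -> f k' * k'^-1 \in A.
Proof.
move=> kk'; have sAF : A \subset F := cycle_abelian x.
have /cycleP[i fx] := Aut_setT_cyclic (subsetP sAF _ (cycle_id x)).
have fA u : u \in A -> f u = u ^+ i.
  by case/cycleP=> j ->; rewrite Aut_setTX fx -!expgM mulnC.
have : f k' * k'^-1 \in F.
  apply/centP=> y Ay.
  have [v Av fv] : exists2 v, v \in A & f v = y.
    exists (f^-1 y); last by rewrite permKV.
    by rewrite -(Aut_setT_char _ (md_cyclic_char sAF)) permKV.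
  have E : y ^ f k' = y ^ k'.
    rewrite -fv [in RHS](fA v Av) conjXg -fA ?md_memJ // !conjgE !Aut_setTM.
    by rewrite Aut_setTV.
  by apply: esym; apply/commgP/conjg_fixP; rewrite conjgM E -conjgM mulgV conjg1.
case/md_centP=> a Aa [c Zc] E; rewrite E groupMr //.
have fk' : f k' = a * k' * c by rewrite -[f k'](mulgKV k') E -!mulgA (md_mulC k') ?mulgA.
pose m := #[k'].
have cm : (a * k' * c) ^+ m = (a * k') ^+ m * c ^+ m by apply: expgMn; apply/esym/md_mulC.
have [b Ab bm] : exists2 b, b \in A & (a * k') ^+ m = b * k' ^+ m.
  elim: {cm} m => [|n [b Ab IH]]; first by exists 1; rewrite ?group1 ?mulg1.
  exists (a * b ^ k'^-1); first by rewrite groupM ?md_memJ.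
  by rewrite !expgS IH conjgE invgK !mulgA mulgKV.
have : f k' ^+ m = 1 by rewrite -Aut_setTX expg_order Aut_setT_morph1.
rewrite fk' cm bm expg_order mulg1 => bc1.
have cm1 : c ^+ m = 1.
  have : c ^+ m \in A :&: Z.
    by rewrite inE (groupX _ Zc) andbT -(mulKg b (c ^+ m)) bc1 mulg1 groupV.
  by rewrite (coprime_TIg (md_coxz D)) => /set1P.
suff -> : c = 1 by rewrite group1.
apply/eqP; rewrite -order_eq1 -dvdn1.
have /eqP<- : coprime #[c] m.
  apply: coprime_dvdl (order_dvdG Zc) _; apply: coprime_dvdr (md_cozk D).
  exact: order_dvdG.
by rewrite dvdn_gcd dvdnn order_dvdn cm1 eqxx.
Qed.

End Aut.

(** Since [k'] squares to 1, it commutes with [u * u ^ k']. *)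
Lemma md_invol_conj k' u :
  'C_A[k'] = 1 -> k' * k' = 1 -> u \in A -> u ^ k' = u^-1.
Proof.
move=> CAk' kk Au; have Auk := md_memJ k' Au.
have : u * u ^ k' \in 'C_A[k'].
  rewrite inE groupM //=; apply/cent1P/commgP/conjg_fixP.
  rewrite conjMg -conjgM kk conjg1.
  by apply: (centsP (cycle_abelian x)).
by rewrite CAk' => /set1P uu; apply: (mulgI u); rewrite mulgV.
Qed.

(** The connection set is [S0 :|: W :* k' :|: (W :* k')^-1].  The hypotheses on [N]
    and [H] make the Cayley graph a non-GRR, the last one makes [AutS] trivial.
    The closure of [W] under [a c |-> a c^-1] is needed when [k'] is an involution:
    then [(W :* k')^-1] lies in the same coset of [F] as [W :* k']. *)
Lemma not_GRR_detecting_by_rigidity k' (S0 W : {set gT}) (N H : {group gT}) :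
    k' \in <[k]> -> k' != 1 -> 'C_A[k'] = 1 ->
    S0 \subset F -> S0^-1 = S0 -> W \subset F ->
    (forall a c, a \in A -> c \in Z -> a * c \in W -> a * c^-1 \in W) ->
    N <| [set: gT] -> N :!=: 1 -> N \subset H -> H \proper [set: gT] ->
    (forall s n, s \in S0 -> s \notin H -> n \in N -> s * n \in S0) ->
    (forall w n, w \in W -> w * k' \notin H -> n \in N -> w * n \in W) ->
    (forall (f : {perm gT}) t, f \in Aut [set: gT] ->
       (forall u, u \in S0 -> f u \in S0) -> t \in A ->
       (forall w, w \in W -> f w * t \in W) -> t = 1 /\ {in F, f =1 id}) ->
  ~ GRR_detecting gT.
Proof.
move=> kk' ntk' CAk' sS0F S0V sWF WV nN ntN sNH ltHG S0N WN rig GD.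
have NJ m y : m \in N -> m ^ y \in N.
  by move=> Nm; rewrite memJ_norm // (subsetP (normal_norm nN)) ?inE.
have F'k' : k' \notin F.
  apply: contra ntk' => Fk'; rewrite -in_set1 -[[set 1]](md_faithful D).
  by rewrite inE kk'.
have mWk w y : (w * y \in W :* y) = (w \in W) by rewrite mem_rcoset mulgK.
pose S := S0 :|: (W :* k' :|: (W :* k')^-1).
have SV : S^-1 = S by rewrite /S !invUg S0V invgK [_^-1 :|: _]setUC.
have SF u : u \in F -> (u \in S) = (u \in S0).
  move=> Fu; have notW y : y \in F -> y \notin W :* k'.
    move=> Fy; rewrite mem_rcoset; apply: contra F'k' => /(subsetP sWF).
    by rewrite groupMl // groupV.
  by rewrite !inE (negPf (notW _ Fu)) (negPf (notW _ _)) ?groupV ?orbF.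
have SFk u : u \in F -> (u * k' \in S) = (u \in W).
  move=> Fu; rewrite !inE mWk.
  have /negPf-> : u * k' \notin S0.
    by apply: contra F'k' => /(subsetP sS0F); rewrite groupMl.
  rewrite /=; apply/orb_idr; rewrite mem_rcoset => Ww; set w := _ * _ in Ww.
  have Fw := subsetP sWF _ Ww.
  (* Here [u * k'] is also the inverse of [w * k'], so [k' * k'] centralises [A] and is 1 by
     faithfulness. Then [k'] inverts [A] and fixes [Z], which turns [w = a * c] into
     [u = a * c^-1]. *)
  have kk : k' * k' = 1.
    apply/set1P; rewrite -[[set 1]](md_faithful D) inE groupM //=.
    have -> : k' * k' = (w ^ k' * u)^-1.
      by rewrite /w conjgE !invMg !invgK !mulgA mulgKV mulVg mul1g.
    by rewrite groupV groupM // memJ_norm // (subsetP (char_norm md_cent_char)) ?inE.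
  have kV : k'^-1 = k' by apply/eqP; rewrite eq_invg_mul kk.
  have [a Aa [c Zc Ew]] := md_centP _ Fw.
  have -> : u = a * c^-1.
    apply: invg_inj; rewrite invMg invgK (md_mulC a^-1 Zc).
    rewrite -(md_invol_conj CAk' kk Aa) conjgE -!mulgA -(md_mulC k' Zc) !mulgA -(mulgA _
      a) -Ew.
    by rewrite /w invMg !mulgA mulgKV -[k'^-1 * _]invMg kk invg1 mul1g.
  by apply: WV => //; rewrite -Ew.
suff AS1 : AutS S = 1.
  have [_ eqCR] := GD S SV AS1.
  suff : CayAut S != rreg gT by rewrite eqCR eqxx.
  apply: (CayAut_neq_rreg nN ntN sNH ltHG).
  move=> s n; rewrite !inE => /or3P[Ss|Ws|Ws] nHs Nn.
  - by rewrite S0N.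
  - have nHw : s * k'^-1 * k' \notin H by rewrite mulgKV.
    rewrite mem_rcoset in Ws; have Wn := WN _ (n ^ k'^-1) Ws nHw.
    apply/orP; right; apply/orP; left; rewrite mem_rcoset.
    have -> : s * n * k'^-1 = s * k'^-1 * n ^ k'^-1 by rewrite conjgE invgK !mulgA mulgKV.
    by apply: Wn; rewrite NJ.
  - have nHw : s^-1 * k'^-1 * k' \notin H by rewrite mulgKV groupV.
    rewrite mem_rcoset in Ws; apply/orP; right; apply/orP; right; rewrite mem_rcoset.
    have -> : (s * n)^-1 * k'^-1 = s^-1 * k'^-1 * n^-1 ^ (s^-1 * k'^-1).
      by rewrite -conjgC invMg mulgA.
    by apply: WN => //; rewrite NJ ?groupV.
have AS_1 : 1 \in AutS S.
  by rewrite inE group1; apply/eqP; rewrite -[RHS]imset_id; apply: eq_imset => y;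
    rewrite perm1.
apply/eqP; rewrite eqEsubset sub1set AS_1 andbT; apply/subsetP=> f;
  rewrite inE => /andP[Af /eqP fS].
have fSE y : (f y \in S) = (y \in S).
  by rewrite -{1}fS mem_imset //; apply: perm_inj.
have fF y : (f y \in F) = (y \in F) by apply: Aut_setT_char md_cent_char.
pose t := f k' * k'^-1.
have At : t \in A by apply: Aut_setT_shift.
have Ft : t \in F := subsetP (cycle_abelian x) _ At.
have fk' : f k' = t * k' by rewrite mulgKV.
have [||t1 fid] := rig f t Af _ At.
- by move=> u Su; rewrite -SF ?fF ?fSE ?SF ?(subsetP sS0F).
- move=> w Ww; have Fw := subsetP sWF _ Ww.
  have Fwt : f w * t \in F by rewrite groupM ?fF.
  by rewrite -(SFk _ Fwt) -mulgA -fk' -Aut_setTM // fSE SFk.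
have fk'1 : f k' = k' by rewrite fk' t1 mul1g.
(* Both [f k] and [k] commute with [k'], so their quotient is an element of [A] fixed by [k']. *)
have fk : f k = k.
  have As : f k * k^-1 \in A by rewrite Aut_setT_shift ?cycle_id.
  suff : f k * k^-1 \in 'C_A[k'] by rewrite CAk' => /set1P s1;
    rewrite -[f k](mulgKV k) s1 mul1g.
  have ckk' : commute k k' by case/cycleP: kk' => i ->; apply: commuteX.
  have cfk : commute (f k) k' by rewrite /commute -{1 2}fk'1 -!Aut_setTM // ckk'.
  rewrite inE As; apply/cent1P; apply: commute_sym; apply: commuteM;
    first exact: commute_sym.
  by apply: commuteV; apply: commute_sym.
apply/set1P/permP=> y; rewrite perm1.
have : y \in [set: gT] by rewrite inE.
rewrite -(md_prod D) -(md_cent D) => /mulsgP[u _ Fu /cycleP[i ->] ->].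
by rewrite Aut_setTM // Aut_setTX // fk fid.
Qed.

End Rigidity.

(** * Subsets of a cyclic group without dihedral symmetry *)

(** A subset of [<[x]>] with trivial stabiliser in the dihedral group of maps
    [u |-> u^(+-1) t], as soon as [x] has order at least 7. *)
Definition triple (gT : finGroupType) (x : gT) : {set gT} := [set 1; x; x ^+ 3].

Lemma triple_sub (gT : finGroupType) (x : gT) : triple x \subset <[x]>.
Proof.
by apply/subsetP=> y; rewrite !inE => /orP[/orP[]|] /eqP->;
  rewrite ?group1 ?cycle_id ?mem_cycle.
Qed.

(** The bound 7 admits the exponents up to 3 + 3 compared in [triple_rigid]. *)
Lemma expg_inj_small (gT : finGroupType) (x : gT) m n :
  6 < #[x] -> x ^+ m = x ^+ n -> m < 7 -> n < 7 -> m = n.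
Proof.
move=> ox /eqP; rewrite eq_expg_mod_order => /eqP E lm ln.
by move: E; rewrite !modn_small // (leq_trans _ ox).
Qed.

Lemma sqr_notin_triple (gT : finGroupType) (x : gT) :
  6 < #[x] -> x ^+ 2 \notin triple x.
Proof.
move=> ox; rewrite !inE; apply/negP=> /orP[/orP[]|] /eqP.
- by move/(@expg_inj_small _ _ 2 0 ox)/(_ isT isT).
- by move/(@expg_inj_small _ _ 2 1 ox)/(_ isT isT).
- by move/(@expg_inj_small _ _ 2 3 ox)/(_ isT isT).
Qed.

(** With exponents in {0, 1, 3}, the case [y = x] gives [i + 1 = j], hence [i = 0]. The case of the
    inverse gives [i = j + 1] and [i = 3 + l], forcing [i = 1] and [i = 3] at once. *)
Lemma triple_rigid (gT : finGroupType) (x y t : gT) :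
    6 < #[x] -> y \in [set x; x^-1] ->
    (forall w, w \in triple y -> w * t \in triple x) ->
  t = 1 /\ y = x.
Proof.
move=> ox xy T.
have tripleP u : u \in triple x -> exists2 i, i \in [:: 0; 1; 3]%N & u = x ^+ i.
  rewrite !inE => /orP[/orP[]|] /eqP->; [exists 0%N|exists 1%N|exists 3%N] => //.
have inj m n := @expg_inj_small _ x m n ox.
have [i Ii Ei] := tripleP _ (T 1 (ltac:(by rewrite !inE eqxx))).
have [j Ij Ej] := tripleP _ (T y (ltac:(by rewrite !inE eqxx orbT))).
have [l Il El] := tripleP _ (T (y ^+ 3) (ltac:(by rewrite !inE eqxx !orbT))).
rewrite mul1g in Ei; move: Ej El; rewrite Ei.
move: xy; rewrite !inE => /orP[] /eqP-> Ej El.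
  rewrite -expgS in Ej; move/inj: Ej.
  by move: Ii Ij; rewrite !inE => /or3P[] /eqP-> /or3P[] /eqP-> // /(_ isT isT).
have E1 : x ^+ i = x ^+ j.+1 by rewrite expgS -Ej mulKVg.
have E2 : x ^+ i = x ^+ (3 + l) by rewrite expgD -El mulgA -expgMn ?mulgV ?expg1n ?mul1g
  //; apply: commuteV.
move/inj: E1; move/inj: E2.
by move: Ii Ij Il; rewrite !inE => /or3P[] /eqP-> /or3P[] /eqP-> /or3P[] /eqP-> // /(_
  isT isT) // _ /(_ isT isT).
Qed.

(** * Connection sets for the non-detecting groups *)

Section Cases.

Variables (gT : finGroupType) (x z k : gT).
Hypothesis D : metacyclic_data x z k.

Local Notation A := <[x]>.
Local Notation Z := <[z]>.
Local Notation F := 'C(A).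

Let sAF : A \subset F := cycle_abelian x.

Let sZF : Z \subset F.
Proof. by rewrite (md_cent D) mulG_subr. Qed.

(** Conjugation by [k] preserves [<[u]>], whose only possible nontrivial element is [u], so [k]
    fixes [u]. *)
Lemma md_sqr_eq1 u : u \in A -> u ^+ 2 = 1 -> u = 1.
Proof.
move=> Au u2; have Fu := subsetP sAF _ Au.
have nu : <[u]> <| [set: gT] by apply/char_normal/(md_cyclic_char D); rewrite cycle_subG.
have /cycleP[i Ei] : u ^ k \in <[u]>.
  by rewrite memJ_norm ?cycle_id // (subsetP (normal_norm nu)) ?inE.
have := expg_mod i u2; rewrite -Ei modn2; case: (odd i) => /= uk.
  suff : u \in 'C_A[k] by rewrite (md_regular D) => /set1P.
  by rewrite inE Au /=; apply/cent1P/commgP/conjg_fixP; rewrite -uk expg1.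
by apply: (conjg_inj k); rewrite -uk conj1g.
Qed.

Lemma md_odd : odd #[x].
Proof.
apply: contraT; rewrite -dvdn2 => d2.
have [//|u Au ou] := @Cauchy _ 2 <[x]>%G _ d2.
have u1 := md_sqr_eq1 Au (etrans (congr1 _ (esym ou)) (expg_order u)).
by rewrite u1 order1 in ou.
Qed.

Lemma md_uniq a b c d :
  a \in A -> b \in A -> c \in Z -> d \in Z -> a * c = b * d -> a = b /\ c = d.
Proof.
move=> Aa Ab Zc Zd E.
have : b^-1 * a \in A :&: Z.
  rewrite inE groupM ?groupV //=.
  by rewrite -(mulgK c a) E !mulgA mulVg mul1g groupM ?groupV.
rewrite (coprime_TIg (md_coxz D)) => /set1P ba1.
have ab : a = b by rewrite -(mulKVg b a) ba1 mulg1.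
by split=> //; apply: (mulgI a); rewrite E ab.
Qed.

Lemma md_k_notin_cent : x != 1 -> k \notin F.
Proof.
move=> ntx; apply/negP=> Fk; case/negP: ntx; apply/eqP/set1P.
rewrite -[[set 1]](md_regular D) inE cycle_id /=; apply/cent1P.
by apply/esym/(centP Fk)/cycle_id.
Qed.

Lemma md_k_neq1 : x != 1 -> k != 1.
Proof. by move/md_k_notin_cent; apply: contraNneq => ->; rewrite group1. Qed.

Lemma md_cent_proper : x != 1 -> F \proper [set: gT].
Proof. by move/md_k_notin_cent => nFk; apply/properP; rewrite subsetT; split=> //;
  exists k; rewrite ?inE. Qed.

(** On [<[g]>] the map is the identity or inversion; a fixed element with nontrivial square excludes
    inversion. *)
Lemma md_gen_rigid f g u v :
    f \in Aut [set: gT] -> f g \in [set g; g^-1] -> u \in <[g]> -> v \in <[g]> ->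
  f u = u -> u ^+ 2 != 1 -> f v = v.
Proof.
move=> Af fg /cycleP[i ->] /cycleP[j ->]; rewrite !(Aut_setTX Af).
move: fg; rewrite !inE => /orP[] /eqP-> //.
rewrite expgVn => E; rewrite expgS expg1 -{1}E mulVg eqxx //.
Qed.

Lemma Aut_gen_sign f (g u : gT) :
    f \in Aut [set: gT] -> f g \in [set g; g^-1] -> u \in <[g]> ->
  f u \in [set u; u^-1].
Proof.
move=> Af fg /cycleP[i ->]; rewrite (Aut_setTX Af) !inE -expgVn.
by move: fg; rewrite !inE => /orP[] /eqP->; rewrite eqxx ?orbT.
Qed.

Lemma set2V (g : gT) : [set g; g^-1]^-1 = [set g; g^-1].
Proof. by rewrite invUg !invg_set1 invgK setUC. Qed.

Lemma order_gt6_neq1 (u : gT) : 6 < #[u] -> u != 1.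
Proof. by apply: contraTneq => ->; rewrite order1. Qed.

Lemma order_gt6_sqr_neq1 (u : gT) : 6 < #[u] -> u ^+ 2 != 1.
Proof. by rewrite -order_dvdn => o6; rewrite gtnNdvd // (leq_trans _ o6). Qed.

Lemma triple_Aut (f : {perm gT}) (u w : gT) :
  f \in Aut [set: gT] -> w \in triple (f u) -> exists2 v, v \in triple u & w = f v.
Proof.
move=> Af; rewrite !inE => /orP[/orP[]|] /eqP->.
- by exists 1; rewrite ?(Aut_setT_morph1 Af) ?inE ?eqxx.
- by exists u; rewrite ?inE ?eqxx ?orbT.
- by exists (u ^+ 3); rewrite ?(Aut_setTX Af) ?inE ?eqxx ?orbT.
Qed.

(** [S0] consists of a generator of [F] and its inverse; [W] is the triple of [x] spread over
    [Z]-cosets. As [W] meets [A] in the triple alone, [triple_rigid] yields both [t = 1] and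
    [f x = x]. *)
Lemma not_detecting_center_large :
  6 < #[x] -> z != 1 -> ~ GRR_detecting gT.
Proof.
move=> ox ntz; have ntx := order_gt6_neq1 ox.
pose W := triple x * Z.
have TA := subsetP (triple_sub x).
have WA u : u \in A -> u \in W -> u \in triple x.
  move=> Au /mulsgP[w c Tw Zc E].
  by have [||-> _] := @md_uniq u w 1 c Au (TA w Tw) _ Zc; rewrite ?mulg1.
apply: (@not_GRR_detecting_by_rigidity _ _ _ _ D k [set x * z;
  (x * z)^-1] W <[z]>%G 'C(<[x]>)%G).
- exact: cycle_id.
- exact: md_k_neq1.
- exact: (md_regular D).
- by apply/subsetP=> u; rewrite (md_cent_cycle D) !inE => /orP[]/eqP->;
    rewrite ?groupV cycle_id.
- exact: set2V.
- by rewrite (md_cent D) mulSg // triple_sub.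
- move=> a c Aa Zc /mulsgP[w c' Tw Zc' E]; apply/mulsgP; exists w (c' * c^-1 * c^-1) => //.
    by rewrite !groupM ?groupV.
  by rewrite !mulgA -E mulgK.
- by apply/char_normal/(md_cyclic_char D).
- by rewrite /= cycle_eq1.
- exact: sZF.
- exact: md_cent_proper.
- move=> s n Ss; case/negP; rewrite /= (md_cent_cycle D).
  by move: Ss; rewrite !inE => /orP[]/eqP->; rewrite ?groupV cycle_id.
- move=> w n /mulsgP[v c Tv Zc ->] _ Zn; rewrite -mulgA mem_mulg // groupM //.
move=> f t Af S0f At Wf.
have fg : f (x * z) \in [set x * z; (x * z)^-1] by apply: S0f; rewrite !inE eqxx.
have gx : x \in <[x * z]> by rewrite -(md_cent_cycle D) (subsetP sAF) ?cycle_id.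
have fAA u : u \in A -> f u \in A by move=> Au;
  rewrite (Aut_setT_char Af u (md_cyclic_char D sAF)).
have [t1 fx] : t = 1 /\ f x = x.
  apply: triple_rigid => //.
    exact: Aut_gen_sign Af fg gx.
  move=> w /(triple_Aut Af)[v Tv ->]; apply: WA; first by rewrite groupM // fAA ?TA.
  by apply: Wf; rewrite -[v]mulg1 mem_mulg.
split=> // v; rewrite (md_cent_cycle D) => gv.
exact: (md_gen_rigid Af fg gx gv fx (order_gt6_sqr_neq1 ox)).
Qed.

(** No bound on [#[x]] is available for a triple, so [W] consists of the [N]-cosets of 1, [x * z]
    and [x * z^-1]; inverting the [Z]-component exchanges the last two. *)
Lemma not_detecting_center_composite n :
  x != 1 -> n \in Z -> n != 1 -> z \notin <[n]> -> ~ GRR_detecting gT.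
Proof.
move=> ntx Zn ntn nNz; set N := <[n]>.
have sNZ : N \subset Z by rewrite cycle_subG.
have NZ := subsetP sNZ.
have zZ := cycle_id z; have xA := cycle_id x.
have xF := subsetP sAF x xA; have zF := subsetP sZF z zZ.
pose W := N :|: (N :* (x * z) :|: N :* (x * z^-1)).
have WP a c : a \in A -> c \in Z -> a * c \in W ->
    [\/ a = 1 /\ c \in N, a = x /\ (c * z^-1 \in N) | a = x /\ (c * z \in N)].
  move=> Aa Zc; rewrite inE => /orP[Nac|]; last rewrite inE => /orP[] /rcosetP[m Nm].
  - by have [||a1 Ec] := @md_uniq a 1 c (a * c) Aa _ Zc (NZ _ Nac); rewrite ?mul1g //;
      constructor 1; rewrite Ec.
  - rewrite mulgA (md_mulC D x (NZ _ Nm)) -mulgA => E.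
    have Zm : m * z \in Z by rewrite groupM ?groupV //; apply: NZ.
    have [ax ->] := md_uniq Aa xA Zc Zm E.
    by constructor 2; rewrite mulgK.
  - rewrite mulgA (md_mulC D x (NZ _ Nm)) -mulgA => E.
    have Zm : m * z^-1 \in Z by rewrite groupM ?groupV //; apply: NZ.
    have [ax ->] := md_uniq Aa xA Zc Zm E.
    by constructor 3; rewrite mulgKV.
have PW a c : a \in A -> c \in Z ->
    [\/ a = 1 /\ c \in N, a = x /\ (c * z^-1 \in N) | a = x /\ (c * z \in N)] -> a * c
      \in W.
  move=> Aa Zc; rewrite !in_setU !mem_rcoset => -[] [-> Nc]; first by rewrite mul1g Nc.
  - by rewrite invMg !mulgA -(md_mulC D x Zc) -[_ * x * z^-1]mulgA -(md_mulC D x (groupVr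
      zZ)) mulgA mulgK Nc orbT.
  - by rewrite (invMg x z^-1) invgK !mulgA -(md_mulC D x Zc) -[_ * x * z]mulgA -(md_mulC
      D x zZ) mulgA mulgK Nc !orbT.
apply: (@not_GRR_detecting_by_rigidity _ _ _ _ D k [set x * z;
  (x * z)^-1] W <[n]>%G 'C(<[x]>)%G).
- exact: cycle_id.
- exact: md_k_neq1.
- exact: (md_regular D).
- by apply/subsetP=> u; rewrite (md_cent_cycle D) !inE => /orP[]/eqP->;
    rewrite ?groupV cycle_id.
- exact: set2V.
- have FN : N \subset F := subset_trans sNZ sZF.
  by rewrite !subUset FN /= !mul_subG ?sub1set ?groupM ?groupV.
- move=> a c Aa Zc /(WP _ _ Aa Zc) Wac; apply: PW => //; first by rewrite groupV.
  case: Wac => -[-> Nc]; [constructor 1|constructor 3|constructor 2]; split=> //;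
    rewrite -groupV ?invgK //.
    by rewrite invMg invgK (md_mulC D) ?groupV.
  by rewrite invMg !invgK (md_mulC D).
- by apply/char_normal/(md_cyclic_char D)/(subset_trans sNZ).
- by rewrite /= cycle_eq1.
- exact: subset_trans sNZ sZF.
- exact: md_cent_proper.
- move=> s m Ss; case/negP; rewrite /= (md_cent_cycle D).
  by move: Ss; rewrite !inE => /orP[]/eqP->; rewrite ?groupV cycle_id.
- move=> w m Ww _ Nm; have Zm := NZ m Nm.
  by move: Ww; rewrite -(md_mulC D w Zm) !in_setU !mem_rcoset -!mulgA !(groupMl _ Nm).
move=> f t Af S0f At Wf.
have fg : f (x * z) \in [set x * z; (x * z)^-1] by apply: S0f; rewrite !inE eqxx.
(* The image of 1 gives [t] in [W]; its [Z]-component is 1, and only the coset [N] allows this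
   because [z] is not in [N]. *)
have t1 : t = 1.
  have : t * 1 \in W by rewrite mulg1 -[t]mul1g -(Aut_setT_morph1 Af) Wf // !inE group1.
  by case/(WP _ _ At (group1 _)) => -[-> //]; rewrite mul1g ?groupV (negPf nNz).
split=> // v; rewrite (md_cent_cycle D).
suff fgE : f (x * z) = x * z by case/cycleP=> i ->; rewrite (Aut_setTX Af) fgE.
have Wg : f (x * z) \in W.
  rewrite -[f _]mulg1 -t1; apply: Wf; apply: PW => //; constructor 2.
  by rewrite mulgV group1.
(* As [x] is nontrivial of odd order, [x^-1] is neither 1 nor [x], so the inverse of [x * z] is
   outside [W]. *)
move: fg Wg; rewrite !inE -!in_setU => /orP[] /eqP-> // .
rewrite invMg (md_mulC D) ?groupV // => /WP[]; rewrite ?groupV //.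
- by case=> /eqP; rewrite invg_eq1 (negPf ntx).
- case=> E _; case/eqP: ntx; apply: md_sqr_eq1 => //.
  by rewrite expgS expg1 -{1}E mulVg.
- case=> E _; case/eqP: ntx; apply: md_sqr_eq1 => //.
  by rewrite expgS expg1 -{1}E mulVg.
Qed.


(** The whole connection set lies in [H], so the coset conditions outside [H] hold vacuously. *)
Lemma not_detecting_subgroup k' :
    z = 1 -> 6 < #[x] -> k' \in <[k]> -> k' != 1 -> 'C_A[k'] = 1 ->
    <[x]> <*> <[k']> \proper [set: gT] ->
  ~ GRR_detecting gT.
Proof.
move=> z1 ox kk' ntk' CAk' ltH; have TA := subsetP (triple_sub x).
have FA : F = A by rewrite (md_cent D) z1 cycle1 mulg1.
have xA := cycle_id x.
have sAH : A \subset <[x]> <*> <[k']> by apply: joing_subl.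
apply: (@not_GRR_detecting_by_rigidity _ _ _ _ D k' [set x;
  x^-1] (triple x) <[x]>%G (<[x]> <*> <[k']>)%G) => //.
- by apply/subsetP=> u; rewrite FA !inE => /orP[]/eqP->; rewrite ?groupV.
- exact: set2V.
- by rewrite FA triple_sub.
- by move=> a c _; rewrite z1 cycle1 => /set1P->; rewrite invg1.
- exact: md_normal D.
- by rewrite /= cycle_eq1 order_gt6_neq1.
- move=> s n Ss; case/negP; apply: (subsetP sAH).
  by move: Ss; rewrite !inE => /orP[]/eqP->; rewrite ?groupV.
- move=> w n Tw; case/negP; apply: groupM; first exact/(subsetP sAH)/TA.
  by apply: (subsetP (joing_subr _ _)); apply: cycle_id.
move=> f t Af S0f At Tf.
have fx : f x \in [set x; x^-1] by apply: S0f; rewrite !inE eqxx.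
have [t1 fxE] : t = 1 /\ f x = x.
  by apply: triple_rigid => // w /(triple_Aut Af)[v Tv ->]; apply: Tf.
by split=> // v; rewrite FA => /cycleP[i ->]; rewrite (Aut_setTX Af) fxE.
Qed.

(** Take [N = P] and [H] generated by [P] and [k]. The triple of [x1] gives rigidity inside [H],
    while the full coset [P :* y] controls the action on [<[y]>]. *)
Lemma not_detecting_split x1 y :
    z = 1 -> x1 \in A -> y \in A -> <[x1]> :&: <[y]> = 1 ->
    <[x1]> * <[y]> = A -> 6 < #[x1] -> y != 1 ->
  ~ GRR_detecting gT.
Proof.
move=> z1 Ax1 Ay tiPy defA ox1 nty; pose P := <[x1]>.
have FA : F = A by rewrite (md_cent D) z1 cycle1 mulg1.
have abA := centsP (cycle_abelian x).
have sPA : P \subset A by rewrite cycle_subG.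
have PA := subsetP sPA.
have sPF : P \subset F by rewrite FA.
have syF : <[y]> \subset F by rewrite FA cycle_subG.
have tiP u : u \in P -> u \in <[y]> -> u = 1.
  by move=> Pu yu; apply/set1P; rewrite -[[set 1]]tiPy inE Pu.
have nPy : y \notin P by apply: contra nty => /tiP->; rewrite ?cycle_id.
have nPy2 : y * y \notin P.
  apply: contra nty => /tiP y2; apply/eqP/md_sqr_eq1 => //.
  by rewrite expgS expg1 y2 // groupM ?cycle_id.
have nPyV : y^-1 \notin P by rewrite groupV.
have ntx : x != 1 by apply: contraNneq nty => x1E; move: Ay; rewrite x1E cycle1 => /set1P->.
have TP := subsetP (triple_sub x1).
pose H := (<[x1]> <*> <[k]>)%G.
have nPG : <[x1]> <| [set: gT] by apply/char_normal/(md_cyclic_char D).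
have sPH : P \subset H by apply: joing_subl.
have kH : k \in H by apply: (subsetP (joing_subr _ _)); apply: cycle_id.
pose S0 := [set x1; x1^-1] :|: (P :* y :|: P :* y^-1).
pose W := triple x1 :|: P :* y.
have PyV : (P :* y)^-1 = P :* y^-1.
  apply/setP=> u; rewrite mem_invg !mem_rcoset invgK -[RHS]groupV invMg.
  have [Au|nAu] := boolP (u \in A); first by rewrite (abA u^-1 _ y^-1) ?groupV.
  transitivity false; [apply/negbTE|apply/esym/negbTE]; apply: contra nAu => /PA.
    by rewrite groupMr ?groupV.
  by rewrite groupMl ?groupV.
have Pyn s c n : s \in P :* c -> c \in A -> n \in P -> s * n \in P :* c.
  move=> /rcosetP[m Pm ->] Ac Pn; rewrite mem_rcoset -(mulgA m) (abA c Ac n (PA n Pn)).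
  by rewrite mulgA mulgK groupM.
apply: (@not_GRR_detecting_by_rigidity _ _ _ _ D k S0 W <[x1]>%G H) => //.
- exact: cycle_id.
- exact: md_k_neq1.
- exact: (md_regular D).
- rewrite FA !subUset !sub1set groupV Ax1 /=.
  by rewrite !mul_subG ?sub1set ?groupV.
- by rewrite /S0 !invUg -invUg set2V PyV -PyV invgK PyV [_ :* _^-1 :|: _]setUC.
- rewrite FA subUset (subset_trans (triple_sub x1)) //=.
  by rewrite mul_subG ?sub1set.
- by move=> a c _; rewrite z1 cycle1 => /set1P->; rewrite invg1.
- by rewrite /= cycle_eq1 order_gt6_neq1.
- rewrite properE subsetT /=; apply/negP=> /subsetP/(_ y); rewrite inE => /(_ isT).
  rewrite /= norm_joinEr => [/mulsgP[u v Pu kv Ey]|]; last first.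
    by apply: subset_trans (normal_norm nPG); apply: subsetT.
  case/negP: nPy; suff v1 : v = 1 by rewrite Ey v1 mulg1.
  apply/set1P; rewrite -[[set 1]](md_faithful D) inE kv FA -(mulKg u v) -Ey.
  by rewrite groupM ?groupV //; apply: PA.
- move=> s n; rewrite !in_setU => /orP[Ss|/orP[] Ps] nHs Pn.
  + case/negP: nHs; apply: (subsetP sPH); move: Ss; rewrite !inE => Ss.
    by case/orP: Ss => /eqP->; rewrite ?groupV cycle_id.
  + by rewrite (Pyn s y) ?orbT.
  + by rewrite (Pyn s y^-1) ?groupV ?orbT.
- move=> w n; rewrite in_setU => /orP[Tw|Pw] nHs Pn;
    last by rewrite in_setU (Pyn w y) ?orbT.
  by case/negP: nHs; apply: groupM => //; apply: (subsetP sPH); exact: TP.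
move=> f t Af S0f At Wf.
have fP u : (f u \in P) = (u \in P) by rewrite (Aut_setT_char Af u (md_cyclic_char D sPF)).
have fy u : (f u \in <[y]>) = (u \in <[y]>) by rewrite (Aut_setT_char Af u
  (md_cyclic_char D syF)).
have fx1S : f x1 \in [set x1; x1^-1].
  have : f x1 \in S0 by apply: S0f; rewrite !inE eqxx.
  have fPx1 : f x1 \in P by rewrite fP cycle_id.
  by rewrite !in_setU !mem_rcoset !(groupMl _ fPx1) !groupV (negPf nPy) !orbF.
(* [<[y]>] meets [P :* y] only in [y], and [P :* y^-1] only in [y^-1]. *)
have fyS : f y \in [set y; y^-1].
  have : f y \in S0 by apply: S0f; rewrite /S0 !in_setU rcoset_refl !orbT.
  have nfy : f y \notin P by rewrite fP.
  have yfy : f y \in <[y]> by rewrite fy cycle_id.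
  rewrite in_setU => /orP[|]; first by rewrite !inE => /orP[]/eqP E; case/negP: nfy;
    rewrite E ?groupV cycle_id.
  rewrite in_setU !mem_rcoset !inE => /orP[] /tiP E; apply/orP; [left|right]; apply/eqP.
    by rewrite -[LHS](mulgKV y) E ?mul1g // groupM ?groupV ?cycle_id.
  by rewrite -[LHS](mulgK y) -[X in _ * X * _]invgK E ?mul1g // groupM ?groupV ?cycle_id.
have Wt : t \in W by rewrite -[t]mul1g -(Aut_setT_morph1 Af) Wf // !inE eqxx.
have WP u : u \in W -> u \notin P -> u * y^-1 \in P.
  by rewrite in_setU mem_rcoset => /orP[/TP->|].
have WT u : u \in W -> u \in P -> u \in triple x1.
  rewrite in_setU mem_rcoset => /orP[//|Puy] Pu; case/negP: nPyV.
  by rewrite -(groupMl _ Pu).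
have Wy u : u \in P -> u * y \in W by move=> Pu; rewrite in_setU mem_rcoset mulgK Pu orbT.
have Pt : t \in P.
  apply/idPn => nPt; have Pty := WP t Wt nPt.
  move: fyS; rewrite !inE => /orP[]/eqP fyE.
    have Wyt : y * t \in W by rewrite -fyE Wf // -[y]mul1g Wy.
    have nPyt : y * t \notin P.
      apply: contra nPy2; rewrite (abA y _ t) // -{1}(mulgKV y t) -mulgA.
      by rewrite groupMl.
    by case/negP: nPt; have := WP _ Wyt nPyt; rewrite (abA y _ t) // mulgK.
  (* If [f] inverts [y] and [t] is in [P :* y], the coset [P :* y] is carried onto [P]. The element
     [u] is chosen so that [f (u * y) * t] is [x1 ^+ 2], which [W] omits. *)
  pose c := t * y^-1; pose u := f^-1 (x1 ^+ 2 * c^-1).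
  have fu : f u = x1 ^+ 2 * c^-1 by rewrite permKV.
  have Pu : u \in P by rewrite -fP fu groupM ?groupV ?groupX ?cycle_id.
  have : f (u * y) * t \in W by rewrite Wf ?Wy.
  rewrite (Aut_setTM Af) fu fyE -mulgA (abA y^-1 _ t) ?groupV // mulgKV.
  by move/WT; rewrite (negPf (sqr_notin_triple ox1)) mem_cycle => /(_ isT).
(* Otherwise [y^-1 * t] would lie in [P :* y], putting [y * y] in [P]. *)
have fyE : f y = y.
  move: fyS; rewrite !inE => /orP[]/eqP fyE //; case/negP: nPy2.
  have Wyt : y^-1 * t \in W by rewrite -fyE Wf // -[y]mul1g Wy.
  have nPyt : y^-1 * t \notin P by rewrite groupMr.
  have := WP _ Wyt nPyt; rewrite (abA y^-1 _ t) ?groupV // -mulgA groupMl //.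
  by rewrite -invMg groupV.
have [t1 fx1] : t = 1 /\ f x1 = x1.
  apply: triple_rigid => // w /(triple_Aut Af)[v Tv ->].
  by apply: WT; [apply: Wf; rewrite in_setU Tv | rewrite groupM // fP TP].
split=> // v; rewrite FA -defA => /mulsgP[_ _ /cycleP[i ->] /cycleP[j ->] ->].
by rewrite (Aut_setTM Af) !(Aut_setTX Af) fx1 fyE.
Qed.

End Cases.

(** * Exceptional orders and identification of the remaining groups *)

Lemma odd_small_or_large a : odd a -> 1 < a -> [|| 6 < a, a == 3 | a == 5].
Proof. by case: a => [|[|[|[|[|[|[|a]]]]]]]. Qed.

(** Without a prime factor above 6, only 3 and 5 can divide [a], each at most once. *)
Lemma squarefree_odd_composite a :
  squarefree a -> odd a -> 1 < a -> ~~ prime a ->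
  a = 15 \/ exists p, [/\ prime p, 6 < p, (p %| a)%N & p != a].
Proof.
move=> sqa odda a1 npa.
have [/hasP[p]|/hasPn small] := boolP (has (fun p => 6 < p) (primes a)).
  rewrite mem_primes => /and3P[pp _ dpa] p6; right; exists p; split=> //.
  by apply: contraNneq npa => <-.
have small35 p : prime p -> (p %| a)%N -> p = 3 \/ p = 5.
  move=> pp dpa; have := small p; rewrite mem_primes pp dpa ltnW //= => /(_ isT) np.
  have := odd_small_or_large (dvdn_odd dpa odda) (prime_gt1 pp).
  by rewrite (negPf np) /= => /orP[]/eqP; [left|right].
have sq r m : prime r -> a != (r * r * m)%N.
  by move=> rr; apply: (contra_not_neq _ (sqa r rr)) => ->; rewrite dvdn_mulr.
left; pose p := pdiv a; have pp : prime p by apply: pdiv_prime.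
have /dvdnP[m Em] : (p %| a)%N by apply: pdiv_dvd.
have m1 : m != 1%N by apply: contraNneq npa => m1; rewrite Em m1 mul1n.
have m0 : 0 < m by case: m Em {m1} => // E; rewrite E in a1.
pose q := pdiv m; have pq : prime q by apply: pdiv_prime; rewrite ltn_neqAle eq_sym m1.
have /dvdnP[l El] : (q %| m)%N by apply: pdiv_dvd.
have pq35 : (p = 3 \/ p = 5) /\ (q = 3 \/ q = 5).
  by split; apply: small35 => //; rewrite ?pdiv_dvd // Em El -mulnA mulnCA dvdn_mulr.
have pq15 : (p * q)%N = 15.
  have : p != q.
    by apply: contraNneq (sq p l pp) => pq'; rewrite Em El -pq' -mulnA mulnC eqxx.
  by case: pq35 => [[->|->] [->|->]].
have Ea : a = (15 * l)%N by rewrite Em El -pq15 mulnC [(l * q)%N]mulnC mulnA.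
suff l1 : l = 1%N by rewrite Ea l1.
apply/eqP; apply: contraT => nl1; have l0 : 0 < l by case: l Ea {El nl1} => // E;
  rewrite E in a1.
have pr : prime (pdiv l) by apply: pdiv_prime; rewrite ltn_neqAle eq_sym nl1.
have /dvdnP[i Ei] : (pdiv l %| l)%N by apply: pdiv_dvd.
have [r3|r5] : pdiv l = 3 \/ pdiv l = 5.
- by apply: small35 => //; rewrite Ea dvdn_mull ?pdiv_dvd.
- by case/eqP: (sq 3 (5 * i)%N isT); rewrite Ea Ei r3 [(i * 3)%N]mulnC !mulnA.
- by case/eqP: (sq 5 (3 * i)%N isT); rewrite Ea Ei r5 [(i * 5)%N]mulnC !mulnA.
Qed.

Lemma isog_dprod_setX (gT rT1 rT2 : finGroupType) (H1 H2 G : {group gT})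
    (K1 : {group rT1}) (K2 : {group rT2}) :
  H1 \x H2 = G -> H1 \isog K1 -> H2 \isog K2 -> G \isog setX K1 K2.
Proof.
move=> defG iso1 iso2; apply: (isog_dprod defG (setX_dprod K1 K2)).
  exact: isog_trans iso1 (isog_setX1 _ _).
exact: isog_trans iso2 (isog_set1X _ _).
Qed.

Section Classification.

Variables (gT : finGroupType) (x z k : gT).
Hypothesis D : metacyclic_data x z k.
Hypothesis sqG : squarefree #|gT|.

Local Notation A := <[x]>.
Local Notation Z := <[z]>.
Local Notation F := 'C(A).

Lemma squarefree_order (u : gT) : squarefree #[u].
Proof. by apply: squarefree_dvdn sqG; rewrite -cardsT order_dvdG ?inE. Qed.

Lemma md_nA (u : gT) : <[u]> \subset 'N(A).
Proof. exact: subset_trans (subsetT _) (normal_norm (md_normal D)). Qed.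

Lemma md_tiAk : A :&: <[k]> = 1.
Proof. exact: coprime_TIg (md_coxk D). Qed.

(** Faithfulness embeds [<[k]>] in the automorphism group of [<[x]>]. *)
Lemma md_order_k_dvd_totient : #[k] %| totient #[x].
Proof.
have := card_quotient_cent_cyclic (md_nA k) (cycle_cyclic x).
by rewrite [<[k]> :&: _](md_faithful D) -(card_isog (quotient1_isog _)).
Qed.

Lemma md_order_k_small : x != 1 -> #[x] \in [:: 3; 5; 15]%N -> #[k] = 2%N.
Proof.
move=> ntx ox; have ntk := md_k_neq1 D ntx.
have [j dj] : exists j, (#[k] %| 2 ^ j)%N.
  (* The totients of 3, 5 and 15 are 2, 4 and 8. *)
  have := md_order_k_dvd_totient; move: ox; rewrite !inE => /or3P[] /eqP->.
  - by exists 1%N.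
  - by exists 2%N.
  - by exists 3%N.
have [[|[|i]] _ ok] := dvdn_pfactor _ _ (isT : prime 2) dj => //.
- by case/eqP: ntk; apply/eqP; rewrite -order_eq1 ok.
- by case: (@squarefree_order k 2 isT); rewrite ok !expnS mulnA dvdn_mulr.
Qed.

(** The involution [k] inverts [x], so [(x, k)] satisfies the dihedral presentation. The subscript
    of ['D_] is the group order, hence the doubling. *)
Lemma md_dihedral : x != 1 -> #[k] = 2%N -> <[x]> <*> <[k]> \isog 'D_(#[x].*2).
Proof.
move=> ntx ok; have a1 : 1 < #[x] by rewrite order_gt1.
apply/(isoGrpP _ (Grp_dihedral a1)); split.
  rewrite card_dihedral //= norm_joinEr ?md_nA // TI_cardMg ?md_tiAk //.
  by rewrite -muln2 -ok.
apply/existsP; exists (x, k); rewrite /= !xpair_eqE eqxx expg_order -ok expg_order eqxx /=.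
apply/eqP; apply: (md_invol_conj D (md_regular D)); last exact: cycle_id.
by rewrite -[k * k]/(k ^+ 2) -ok expg_order.
Qed.

Lemma md_dprod : (<[x]> <*> <[k]>) \x Z = [set: gT].
Proof.
have cz : <[x]> <*> <[k]> \subset 'C(Z).
  by apply/subsetP=> u _; apply/centP=> v /(md_mulC D u)/esym.
have co : coprime #|<[x]> <*> <[k]>| #|Z|.
  rewrite norm_joinEr ?md_nA // TI_cardMg ?md_tiAk // coprimeMl.
  by rewrite (md_coxz D) coprime_sym (md_cozk D).
rewrite dprodE ?coprime_TIg // 1?centsC //.
rewrite /= norm_joinEr ?md_nA // -(md_prod D) -!mulgA; congr (_ * _).
apply: normC; apply: cents_norm; apply/subsetP=> u _.
by apply/centP=> v /(md_mulC D u)/esym.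
Qed.

Lemma md_isog_dihedral_prod : x != 1 -> #[k] = 2%N -> prime #[z] ->
  [set: gT] \isog [set: ('D_(#[x].*2) * 'Z_#[z])%type].
Proof.
move=> ntx ok pz.
have -> : [set: ('D_(#[x].*2) * 'Z_#[z])%type] = setX [set: 'D_(#[x].*2)] [set: 'Z_#[z]].
  by apply/setP=> u; rewrite !inE.
apply: (isog_dprod_setX md_dprod (md_dihedral ntx ok)).
rewrite isog_cyclic_card ?cycle_cyclic //= Zp_cycle cycle_cyclic /=.
(* ['Z_n] has [n] elements only for [n] above 1. *)
by rewrite -Zp_cycle cardsT card_ord Zp_cast ?prime_gt1.
Qed.

Lemma md_exceptional_dihedral : x != 1 -> z = 1 -> #[k] = 2%N -> [set: gT] \isog
  'D_(#[x].*2).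
Proof.
move=> ntx z1 ok; have := md_dihedral ntx ok.
by have := md_dprod; rewrite z1 cycle1 dprodg1 => ->.
Qed.

Lemma md_sdprod : z = 1 -> <[x]> ><| <[k]> = [set: gT].
Proof.
by move=> z1; rewrite sdprodE ?md_nA ?md_tiAk // -(md_prod D) z1 cycle1 mulg1.
Qed.

Lemma not_detecting_center : x != 1 -> z != 1 ->
  6 < #[x] \/ ~~ prime #[z] -> ~ GRR_detecting gT.
Proof.
move=> ntx ntz [ox|npz]; first exact: not_detecting_center_large D ox ntz.
pose p := pdiv #[z]; have oz1 : 1 < #[z] by rewrite order_gt1.
have pp : prime p by apply: pdiv_prime.
have dp : (p %| #[z])%N by apply: pdiv_dvd.
have on : #[z ^+ p] = (#[z] %/ p)%N by apply: orderXdiv.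
apply: (not_detecting_center_composite D (n := z ^+ p) ntx); first exact: mem_cycle.
  rewrite -order_dvdn; apply: contra npz => dzp.
  by rewrite (_ : #[z] = p) //; apply/eqP; rewrite eqn_dvd dzp dp.
apply/negP=> /order_dvdG; rewrite -/(order _) on => /dvdn_leq.
rewrite divn_gt0 ?prime_gt0 // dvdn_leq ?order_gt0 // => /(_ isT).
by rewrite leqNgt ltn_Pdiv ?prime_gt1 ?order_gt0.
Qed.

Lemma not_detecting_prime_kernel : z = 1 -> 6 < #[x] -> prime #[x] -> ~~ prime #[k] ->
  ~ GRR_detecting gT.
Proof.
move=> z1 ox px npk; have ntx := order_gt6_neq1 ox.
have ntk := md_k_neq1 D ntx.
pose p := pdiv #[k]; have ok1 : 1 < #[k] by rewrite order_gt1.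
have pp : prime p by apply: pdiv_prime.
have dp : (p %| #[k])%N by apply: pdiv_dvd.
have ok' : #[k ^+ p] = (#[k] %/ p)%N by apply: orderXdiv.
have ntk' : k ^+ p != 1.
  rewrite -order_dvdn; apply: contra npk => dkp.
  by rewrite (_ : #[k] = p) //; apply/eqP; rewrite eqn_dvd dkp dp.
apply: (not_detecting_subgroup D z1 ox (mem_cycle k p) ntk').
  (* [A] has prime order, so a nontrivial fixed point would make [k ^+ p] centralise [A], against
     faithfulness. *)
  apply: prime_TIg => //; apply: contra ntk' => sAC.
  rewrite -in_set1 -[[set 1]](md_faithful D) inE mem_cycle /=.
  by rewrite -cycle_subG centsC (subset_trans sAC) // cent_cycle.
rewrite properEcard subsetT /= cardsT -cardsT.
rewrite norm_joinEr ?md_nA // TI_cardMg; last first.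
  by apply/trivgP; rewrite -md_tiAk setIS // cycleX.
have <- := sdprod_card (md_sdprod z1).
by rewrite ltn_pmul2l ?cardG_gt0 // -!/(order _) ok' ltn_Pdiv ?prime_gt1.
Qed.

(** Squarefreeness splits [<[x]>] into its subgroup of order [p] and the complement generated by
    [x ^+ p]. *)
Lemma not_detecting_composite_kernel p : z = 1 -> prime p -> 6 < p -> p %| #[x] -> p !=
  #[x] ->
  ~ GRR_detecting gT.
Proof.
move=> z1 pp p6 dp npx; have x0 := order_gt0 x.
have ox1 : #[x ^+ (#[x] %/ p)] = p.
  rewrite orderXdiv; last by rewrite -{2}(divnK dp) dvdn_mulr.
  by rewrite -{1}(divnK dp) mulKn // divn_gt0 ?prime_gt0 // dvdn_leq.
have oy : #[x ^+ p] = (#[x] %/ p)%N by apply: orderXdiv.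
have co : coprime #[x ^+ (#[x] %/ p)] #[x ^+ p].
  rewrite ox1 oy; apply: squarefree_coprime.
  by rewrite mulnC divnK //; apply: squarefree_order.
apply: (not_detecting_split D (x1 := x ^+ (#[x] %/ p)) (y := x ^+ p) z1);
  rewrite ?mem_cycle //.
- exact: coprime_TIg.
- apply/eqP; rewrite eqEcard mul_subG ?cycleX //= coprime_cardMg //.
  by rewrite -!/(order _) ox1 oy mulnC divnK.
- by rewrite ox1.
- rewrite -order_dvdn; apply: contra npx => d.
  by rewrite eqn_dvd dp d.
Qed.

End Classification.

Theorem theorem3p3 (gT : finGroupType) :
  squarefree #|gT| ->
  ~~ abelian [set: gT] ->
  ~ ([set: gT] \isog 'D_6) ->
  ~ ([set: gT] \isog 'D_10) ->
  ~ ([set: gT] \isog 'D_30) ->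
  ~ (exists q : nat, prime q /\ [set: gT] \isog [set: ('D_6 * 'Z_q)%type]) ->
  ~ (exists q : nat, prime q /\ [set: gT] \isog [set: ('D_10 * 'Z_q)%type]) ->
  ~ (exists p q : nat, prime p /\ prime q /\
       exists H K : {group gT}, [/\ H ><| K = [set: gT], cyclic H, #|H| = q,
                                   cyclic K & #|K| = p]) ->
  ~ GRR_detecting gT.
Proof.
move=> sqG nabG nD6 nD10 nD30 nD6q nD10q nF.
have [x [z [k D]]] := squarefree_metacyclic sqG.
have ntx : x != 1.
  apply: contra nabG => /eqP x1; apply/commG1P; move: (md_der D).
  by rewrite x1 cycle1 derg1.
have oddx := md_odd D; have ox1 : 1 < #[x] by rewrite order_gt1.
have small_k := md_order_k_small D sqG ntx.
have xcase := odd_small_or_large oddx ox1.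
have [z1|ntz] := eqVneq z 1; last first.
  have [pz|npz] := boolP (prime #[z]); last by apply: (not_detecting_center D) => //; right.
  case/or3P: xcase => [ox|/eqP ox|/eqP ox];
    first by apply: (not_detecting_center D) => //; left.
    case: nD6q; exists #[z]; split=> //.
    by have := md_isog_dihedral_prod D ntx (small_k _) pz; rewrite ox; apply.
  case: nD10q; exists #[z]; split=> //.
  by have := md_isog_dihedral_prod D ntx (small_k _) pz; rewrite ox; apply.
have [px|npx] := boolP (prime #[x]).
  have [pk|npk] := boolP (prime #[k]).
    case: nF; exists #[k], #[x]; do 2!split=> //.
    by exists <[x]>%G, <[k]>%G; rewrite !cycle_cyclic; split=> //; apply: md_sdprod D z1.
  apply: (not_detecting_prime_kernel D) => //.
  (* Order 3 or 5 for [x] forces [#[k] = 2], which is prime. *)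
  case/or3P: xcase => [//|/eqP ox|/eqP ox]; case/negP: npk; rewrite small_k //;
    rewrite ox //.
have [ox|[p [pp p6 dp npa]]] := squarefree_odd_composite (squarefree_order sqG (u := x))
  oddx ox1 npx.
  case: nD30; have := md_exceptional_dihedral D ntx z1 (small_k _); rewrite ox; exact.
exact: (not_detecting_composite_kernel D sqG z1 pp p6 dp npa).
Qed.
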